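(* There is a constant $c>1$ such that $\mathcal{T}(n)\supseteq\{0,1,\dots,c^n\}$ for all $n\ge 1$; that is, every integer $k$ with $0\le k\le c^n$ is the number of domino tilings of some region of size $2n$. Moreover, for all integers $0\le k\le c^n$, a region $\Gamma\subset\mathbb{Z}^2$ with $\tau(\Gamma)=k$ and $|\Gamma|=2n$ can be constructed in time polynomial in $n$.
   Context: A region $\Gamma\subset\mathbb{Z}^2$ is a finite set of unit squares of the square grid (elements of $\mathbb{Z}^2$ are identified with unit squares), not necessarily connected; $|\Gamma|$ is the number of its squares. A domino is a pair of squares sharing an edge (a $2\times1$ or $1\times 2$ rectangle). A domino tiling of $\Gamma$ is a partition of $\Gamma$ into dominoes, and $\tau(\Gamma)$ is the number of domino tilings of $\Gamma$. Denote $\mathcal{T}(n)=\{\tau(\Gamma):\Gamma\subset\mathbb{Z}^2,\ |\Gamma|=2n\}$. *)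

(* Defs.v *)
From HB Require Import structures.
From mathcomp Require Import all_boot all_order all_algebra finmap.
From mathcomp Require Import classical_sets reals.

Set Implicit Arguments.
Unset Strict Implicit.
Unset Printing Implicit Defensive.

Import Order.TTheory GRing.Theory Num.Theory.

Notation square := (int * int)%type.
Notation region := {fset square}.

(* Two unit squares share an edge iff their positions are at l1-distance 1. *)
Definition adjacent (a b : square) : bool :=
  (`|a.1 - b.1| + `|a.2 - b.2| == 1)%R.

Definition dominoes (G : region) : {fset region} :=
  [fset [fset a; b] | a in G, b in G & adjacent a b]%fset.

Definition is_tiling (G : region) (P : {fset region}) : bool :=
  [&& (P `<=` dominoes G)%fset, trivIfset P & fcover P == G].

Definition tau (G : region) : nat :=
  #|` [fset P in fpowerset (dominoes G) | is_tiling G P]%fset|.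

Definition tiling_numbers (n : nat) : set nat :=
  [set k | exists G : region, #|` G| = 2 * n /\ tau G = k]%classic.

(* Words over a finite alphabet encoding the inputs and outputs. *)

Inductive symbol : Type := Bit of bool | Minus | Sep.

Definition symbol_to_option (s : symbol) : option (option bool) :=
  match s with Bit b => Some (Some b) | Minus => Some None | Sep => None end.

Definition symbol_of_option (o : option (option bool)) : symbol :=
  match o with Some (Some b) => Bit b | Some None => Minus | None => Sep end.

Lemma symbol_to_optionK : cancel symbol_to_option symbol_of_option.
Proof. by case. Qed.

HB.instance Definition _ := Finite.copy symbol (can_type symbol_to_optionK).

(* Binary digits, least significant first and without superfluous zeros,
   except that 0 is written with the single digit 0. *)
Definition encode_nat (n : nat) : seq symbol :=
  mkseq (fun i => Bit (odd (n %/ 2 ^ i))) (trunc_log 2 n).+1.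

Definition encode_int (z : int) : seq symbol :=
  if (z < 0)%R then Minus :: encode_nat `|z| else encode_nat `|z|.

Definition encode_square (a : square) : seq symbol :=
  encode_int a.1 ++ Sep :: encode_int a.2 ++ [:: Sep].

Definition encode_squares (s : seq square) : seq symbol :=
  flatten [seq encode_square a | a <- s].

Definition encode_nat_pair (n k : nat) : seq symbol :=
  encode_nat n ++ Sep :: encode_nat k.

(* Deterministic multitape Turing machines with two-way infinite tapes. A cell
   holds None (blank), Some (inl s) for an input/output symbol s, or
   Some (inr w) for an additional work symbol w of the machine. *)

Inductive move : Type := MoveLeft | MoveRight | Stay.

Record turing_machine : Type := TuringMachine {
  state : finType;
  work : finType;
  ntapes : nat; (* the number of tapes minus 1 *)
  start : state;
  halting : pred state;
  delta : state -> {ffun 'I_ntapes.+1 -> option (symbol + work)} ->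
    state * {ffun 'I_ntapes.+1 -> option (symbol + work) * move}
}.

(* The cells on the left of the head (nearest first), the scanned cell, and the
   cells on its right (nearest first); the cells not listed are blank. *)
Record tape (A : Type) : Type := Tape {
  tleft : seq (option A);
  thead : option A;
  tright : seq (option A)
}.

Definition tape_of_word (A : Type) (w : seq A) : tape A :=
  if w is a :: w' then Tape [::] (Some a) (map Some w')
  else Tape [::] None [::].

Definition tape_write (A : Type) (a : option A) (t : tape A) : tape A :=
  Tape (tleft t) a (tright t).

Definition tape_move (A : Type) (m : move) (t : tape A) : tape A :=
  match m with
  | MoveLeft => Tape (behead (tleft t)) (head None (tleft t))
                     (thead t :: tright t)
  | MoveRight => Tape (thead t :: tleft t) (head None (tright t))
                      (behead (tright t))
  | Stay => t
  end.

Fixpoint prefix_before_blank (A : Type) (s : seq (option A)) : seq A :=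
  if s is Some a :: s' then a :: prefix_before_blank s' else [::].

(* The word starting at the head and ending before the first blank. *)
Definition word_of_tape (A : Type) (t : tape A) : seq A :=
  prefix_before_blank (thead t :: tright t).

Section Run.
Variable M : turing_machine.

Local Notation cell := (symbol + work M)%type.

Record config : Type := Config {
  cstate : state M;
  ctapes : {ffun 'I_(ntapes M).+1 -> tape cell}
}.

(* The input is on the first tape. *)
Definition init (w : seq symbol) : config :=
  Config (start M)
    [ffun i => if i == ord0 then tape_of_word (map inl w)
               else tape_of_word [::]].

Definition step (c : config) : config :=
  if halting (cstate c) then c else
  let: (q, acts) := delta (cstate c) [ffun i => thead (ctapes c i)] in
  Config q
    [ffun i => tape_move (acts i).2 (tape_write (acts i).1 (ctapes c i))].

(* Since a halted configuration no longer changes, this says that M has halted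
   after at most t steps; the output is on the last tape. *)
Definition computes_within (w out : seq symbol) (t : nat) : Prop :=
  let c := iter t step (init w) in
  halting (cstate c) /\ word_of_tape (ctapes c ord_max) = map inl out.

End Run.

(* M outputs the squares of G, each exactly once and in some order. *)
Definition constructs_within (M : turing_machine) (w : seq symbol)
    (G : region) (t : nat) : Prop :=
  exists2 s : seq square, perm_eq s (enum_fset G) &
    computes_within M w (encode_squares s) t.

(* Main.v *)
From HB Require Import structures.
Require Import Defs.
From mathcomp Require Import all_boot all_order all_algebra finmap.
From mathcomp Require Import classical_sets reals.
From mathcomp Require Import zify.

(** The number [k] is read off its binary expansion by a ladder. A ladder
    has two rails, in rows 1 and 4, and is described by a pair of numbers:
    the number of its tilings and the number of its tilings once the last
    square of each rail is removed. Two separate squares have the pair (0,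
    1). Adding one block of four columns on the right, whose shape depends
    on a bit [b], turns the pair (k, 1) into (2k + b, 1): a pocket of two
    extra squares doubles the first number, a plain column exchanges the
    two, and a last column adds them if it joins the rails by a rung and
    exchanges them back otherwise ([tau_block]). By Horner's rule the ladder
    with one block per binary digit of [k] has exactly [k] tilings
    ([tau_chain]). It has 2 + 12m squares, where m is the number of digits,
    and isolated dominoes, which do not change the number of tilings,
    complete it to any even size that is at least as large ([tau_layout]).
    As m is about the binary logarithm of [k], this settles all [k <= c ^ n]
    for the sixteenth root c of 2 ([growth_rate_roomy]). The numbers 0 and
    1, for which [n] may be as small as 1, have direct constructions.

    The gadgets are analysed by evaluation. Tilings satisfy a recursion that
    removes the domino covering a chosen square ([tau_expand]); iterating it
    over the squares of a gadget that is attached to an arbitrary region on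
    its left leaves a sum over the sets of boundary squares that the gadget
    uses ([tau_attach]), and the index set of this sum is a computable list.

    The layout is chosen so that a simple machine can print it. Its columns
    are numbered downwards from [n], and on average each column has two
    squares, so a single binary counter that is decremented from [n] to 0
    provides both the coordinates and the control of the size. The digits of
    [k] are read least significant first, one block being printed for each.
    A block has 12 squares but 4 columns; the two missing columns per digit
    are skipped while the head of the input returns to the beginning of [k],
    and one domino per column is printed from there on. A column number has
    at most [n] digits and a row number at most three, so the running time
    is at most quadratic in [n] ([machine_computes]). *)

Set Implicit Arguments.
Unset Strict Implicit.
Unset Printing Implicit Defensive.

Import Order.TTheory GRing.Theory Num.Theory.
Local Open Scope nat_scope.

(** * Counting tilings by removing one domino *)

Section TilingCount.
Local Open Scope fset_scope.
Implicit Types (G D : region) (P : {fset region}).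

Lemma adjacentE (a b : square) :
  adjacent a b = (`|(a.1 - b.1)%R|%N + `|(a.2 - b.2)%R|%N == 1)%N.
Proof. by []. Qed.

Lemma adjacentC (a b : square) : adjacent a b = adjacent b a.
Proof. by rewrite !adjacentE; lia. Qed.

Lemma adjacent_irrefl (a : square) : adjacent a a = false.
Proof. by rewrite adjacentE !subrr. Qed.

Lemma dominoesP G D :
  reflect (exists a b, [/\ a \in G, b \in G, adjacent a b & D = [fset a; b]])
          (D \in dominoes G).
Proof.
apply: (iffP (imfset2P _ _ _ _ _)) => /=.
  by move=> [a aG [b /[!inE] /andP[bG ab] ->]]; exists a, b.
by move=> [a [b [aG bG ab ->]]]; exists a => //; exists b => //; rewrite inE bG.
Qed.

(** The pointwise form of a tiling: the numerical disjointness and covering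
    conditions are awkward when a block is added or removed, these four are
    not. *)
Lemma tilingP G P :
  reflect [/\ {in P, forall D, exists a b, adjacent a b /\ D = [fset a; b]},
              {in P, forall D, D `<=` G},
              {in G, forall z, exists2 D, D \in P & z \in D}
            & {in P &, forall D D' z, z \in D -> z \in D' -> D = D'}]
          (is_tiling G P).
Proof.
apply: (iffP and3P) => [[/fsubsetP PG /trivIfsetP tP /eqP cP]|[dP PG cP tP]].
  split.
  - by move=> D /PG /dominoesP[a [b [_ _ ab ->]]]; exists a, b.
  - by move=> D DP; rewrite -cP; exact: bigfcup_sup.
  - by move=> z; rewrite -cP => /bigfcupP[D /andP[DP _] zD]; exists D.
  - move=> D D' DP D'P z zD zD'; apply/eqP/negPn/negP => /(tP _ _ DP D'P).
    by move=> /fdisjointP /(_ z zD); rewrite zD'.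
split.
- apply/fsubsetP => D DP; apply/dominoesP.
  have [a [b [ab DE]]] := dP D DP; exists a, b.
  by have /fsubsetP sD := PG D DP; split=> //; apply: sD; rewrite DE !inE eqxx ?orbT.
- apply/trivIfsetP => D D' DP D'P neq; apply/fdisjointP => z zD.
  by apply: contra neq => zD'; apply/eqP; apply: tP zD zD'.
- apply/eqP/fsetP => z; apply/bigfcupP/idP => [[D /andP[DP _] zD]|zG].
    by have /fsubsetP := PG D DP; apply.
  by have [D DP zD] := cP z zG; exists D => //; rewrite DP.
Qed.

Definition tilings G : {fset {fset region}} :=
  [fset P in fpowerset (dominoes G) | is_tiling G P].

Lemma in_tilings G P : (P \in tilings G) = is_tiling G P.
Proof.
rewrite !inE /= andb_idl // => /and3P[PG _ _].
by rewrite fpowersetE.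
Qed.

(** Adding the block back is inverse to removing it. *)
Lemma card_tilings_with G (a b : square) :
  a \in G -> b \in G -> adjacent a b ->
  #|` [fset P in tilings G | [fset a; b] \in P]|
  = tau (G `\` [fset a; b]).
Proof.
move=> aG bG ab; set D0 := [fset a; b].
have D0T P : P \in tilings (G `\` D0) -> D0 \notin P.
  rewrite in_tilings => /tilingP[_ PG _ _]; apply/negP => /PG /fsubsetP /(_ a).
  by rewrite !inE eqxx => /(_ isT).
rewrite -[tau _]/(#|` tilings (G `\` D0)|).
transitivity #|` [fset D0 |` P | P in tilings (G `\` D0)]|; last first.
  rewrite card_in_imfset //= => P P' PT P'T eqP'.
  by rewrite -(fsetU1K (D0T _ PT)) eqP' fsetU1K // D0T.
congr #|` _|; apply/fsetP => P; apply/idP/imfsetP => /=; rewrite 2?inE.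
  move=> /andP[PT D0P]; exists (P `\ D0); last by rewrite fsetD1K.
  move: PT; rewrite -!/(tilings _) !in_tilings => /tilingP[dP PG cP tP].
  apply/tilingP; split.
  - by move=> D; rewrite !inE => /andP[_ /dP].
  - move=> D; rewrite !inE => /andP[neq DP]; apply/fsubsetP => z zD.
    rewrite in_fsetD; have /fsubsetP -> := PG D DP; rewrite ?andbT //.
    by apply: contra neq => zD0; apply/eqP; apply: (tP _ _ DP D0P) zD zD0.
  - move=> z; rewrite in_fsetD => /andP[zD0 /cP[D DP zD]]; exists D => //.
    by rewrite in_fsetD1 DP andbT; apply: contraNneq zD0 => <-.
  - by move=> D D'; rewrite !inE => /andP[_ DP] /andP[_ D'P]; exact: tP.
move=> [Q QT ->]; have D0Q := D0T _ QT; move: QT.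
rewrite -!/(tilings _) !in_tilings => /tilingP[dQ QG cQ tQ]; rewrite fset1U1 andbT.
have QD0 D z : D \in Q -> z \in D -> z \notin D0.
  by move=> /QG /fsubsetP sD /sD; rewrite in_fsetD => /andP[].
apply/tilingP; split.
- by move=> D; rewrite !inE => /orP[/eqP ->|/dQ//]; exists a, b.
- move=> D; rewrite !inE => /orP[/eqP ->|/QG sD].
    by apply/fsubsetP => z; rewrite !inE => /orP[] /eqP ->.
  by apply: fsubset_trans sD _; exact: fsubsetDl.
- move=> z zG; have [zD0|zD0] := boolP (z \in D0).
    by exists D0 => //; rewrite !inE eqxx.
  have [|D DQ zD] := cQ z; first by rewrite in_fsetD zD0.
  by exists D => //; rewrite !inE DQ orbT.
- move=> D D'; rewrite !inE => /orP[/eqP ->|DQ] /orP[/eqP ->|D'Q] z zD zD' //.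
  + by move: (QD0 _ _ D'Q zD'); rewrite zD.
  + by move: (QD0 _ _ DQ zD); rewrite zD'.
  + exact: tQ DQ D'Q z zD zD'.
Qed.

(** A fixed square lies in exactly one domino of each tiling, so the tilings
    are classified by the neighbour with which that square is paired. *)
Lemma tau_expand G (a : square) : a \in G ->
  tau G = \sum_(b <- G | adjacent a b) tau (G `\` [fset a; b]).
Proof.
move=> aG.
have -> : tau G = \sum_(P <- tilings G) 1 by rewrite -card_fset_sum1.
rewrite [RHS]big_seq_cond.
under [RHS]eq_bigr => b /andP[bG ab].
  rewrite -card_tilings_with // card_fset_sum1.
  rewrite big_fset big_mkcond /=.
  over.
rewrite -big_seq_cond exchange_big /=.
rewrite big_fset /= [RHS]big_fset /=.
apply: eq_bigr => P /tilingP[dP PG cP tP].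
have [D DP aD] := cP a aG.
have [b [ab DE]] : exists b, adjacent a b /\ D = [fset a; b].
  have [u [v [uv DE]]] := dP D DP; move: aD; rewrite DE !inE.
  case/orP => /eqP ->; first by exists v.
  by exists u; rewrite adjacentC fsetUC.
have bG : b \in G.
  by have /fsubsetP := PG D DP; apply; rewrite DE !inE eqxx orbT.
rewrite big_mkcond (big_fsetD1 b) //= ab -DE DP big1_fset ?addn0 //.
move=> c; rewrite !inE => /andP[cb cG] _; case: ifP => // ac.
case: ifP => // DcP; have: c \in D.
  have <- : [fset a; c] = D by apply: (tP _ _ DcP DP a) => //; rewrite !inE eqxx.
  by rewrite !inE eqxx orbT.
by rewrite DE !inE (negPf cb) orbF => /eqP ca; rewrite ca adjacent_irrefl in ac.
Qed.

Lemma tau_fset0 : tau fset0 = 1.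
Proof.
rewrite -[LHS]/(#|` tilings fset0|).
have -> : tilings fset0 = [fset fset0].
  apply/fsetP => P; rewrite in_tilings inE; apply/tilingP/eqP => [[dP PG _ _]|->].
    apply/fsetP => D; rewrite in_fset0; apply/negP => DP.
    have [a [b [_ DE]]] := dP D DP; have /fsubsetP /(_ a) := PG D DP.
    by rewrite DE !inE eqxx => /(_ isT).
  by split.
exact: cardfs1.
Qed.

End TilingCount.

(** * Attaching squares to the right of a region *)

(** All squares of the construction have natural coordinates, so that the
    machine never prints a sign. *)
Definition sq (x y : nat) : square := (Posz x, Posz y).

Lemma sq_inj x y x' y' : (sq x y == sq x' y') = (x == x') && (y == y').
Proof. by []. Qed.

Section Attach.
Local Open Scope fset_scope.
Implicit Types (R : region) (x y : nat) (p q : nat * nat) (s : seq (nat * nat)).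

(** Coordinates relative to the first column to the right of column [x]: the
    interaction with a region on the left is then independent of [x], and
    can be computed. *)
Definition place x p : square := sq (x + p.1.+1) p.2.

Lemma place_inj x : injective (place x).
Proof. by move=> [i j] [i' j'] [] ? ->; congr pair; lia. Qed.

Definition nat_adjacent p q : bool :=
  [|| (p.1 == q.1) && (p.2 == q.2.+1), (p.1 == q.1) && (q.2 == p.2.+1),
      (p.2 == q.2) && (p.1 == q.1.+1) | (p.2 == q.2) && (q.1 == p.1.+1)].

Lemma adjacent_place x p q : adjacent (place x p) (place x q) = nat_adjacent p q.
Proof. by rewrite adjacentE /nat_adjacent /=; lia. Qed.

(** All ways to cover the new squares [s] completely, each square being
    paired with another new square or, from the first new column, with a
    square of the old column in one of the rows [T]. Each way is recorded as
    the list of rows of the old column that it uses; [f] is fuel. *)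
Fixpoint boundary_uses (f : nat) (T : seq nat) s : seq (seq nat) :=
  match f, s with
  | _, [::] => [:: [::]]
  | 0, _ => [::]
  | f'.+1, p :: s' =>
      flatten [seq boundary_uses f' T (rem q s') | q <- s' & nat_adjacent p q]
      ++ (if (p.1 == 0) && (p.2 \in T)
          then [seq p.2 :: d | d <- boundary_uses f' (rem p.2 T) s'] else [::])
  end.

Definition left_of R x := {in R, forall a : square, (a.1 <= x%:Z)%R}.

Definition layer x s : region := [fset place x p | p in s].

Lemma place_layer x p s : (place x p \in layer x s) = (p \in s).
Proof. by apply: mem_imfset; exact: place_inj. Qed.

Lemma place_left_of R x p : left_of R x -> (place x p \in R) = false.
Proof. by move=> RL; apply/negP => /RL /=; lia. Qed.

Lemma layer_enum R x s : left_of R x -> uniq s ->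
  perm_eq (R `|` layer x s) (enum_fset R ++ map (place x) s).
Proof.
move=> RL us; apply: uniq_perm; first exact: fset_uniq.
  rewrite cat_uniq fset_uniq map_inj_uniq ?us ?andbT; last exact: place_inj.
  by apply/hasPn => _ /mapP[p _ ->]; apply/negP => /RL /=; lia.
move=> a; rewrite mem_cat !inE; congr (_ || _).
by apply/imfsetP/mapP => -[p ps ->]; exists p.
Qed.

Definition column_cells x (d : seq nat) : region := [fset sq x y | y in d].

Lemma in_column x d y : (sq x y \in column_cells x d) = (y \in d).
Proof. by apply: mem_imfset => i j [->]. Qed.

Lemma layer_nil x : layer x [::] = fset0.
Proof. by apply/fsetP => a; rewrite in_fset0; apply/negP => /imfsetP[]. Qed.

Lemma column_cells_nil x : column_cells x [::] = fset0.
Proof. by apply/fsetP => a; rewrite in_fset0; apply/negP => /imfsetP[]. Qed.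

(** The transfer principle: expand along the new squares one at a time, and
    what remains is the old region without the boundary squares already
    used. Since [boundary_uses] computes, it reduces the analysis of a
    gadget to an evaluation. *)
Lemma tau_attach (f x : nat) (T : seq nat) s R :
  size s <= f -> uniq s -> uniq T -> left_of R x ->
  (forall y, (0, y) \in s -> (sq x y \in R) = (y \in T)) ->
  tau (R `|` layer x s)
  = \sum_(d <- boundary_uses f T s) tau (R `\` column_cells x d).
Proof.
elim: f T s R => [|f IH] T [|p s] R //.
- by move=> *; rewrite /= big_seq1 layer_nil column_cells_nil fsetU0 fsetD0.
- by move=> *; rewrite /= big_seq1 layer_nil column_cells_nil fsetU0 fsetD0.
move=> /[!ltnS] sf /andP[ps us] uT RL RT.
rewrite (@tau_expand _ (place x p)); last first.
  by rewrite in_fsetU place_layer mem_head orbT.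
rewrite (perm_big _ (layer_enum RL _)) /=; last exact/andP.
rewrite big_cat [RHS]big_cat /= [LHS]addnC; congr addn.
  rewrite big_cons adjacent_irrefl big_map big_flatten big_map big_filter.
  rewrite (eq_bigl _ _ (adjacent_place x p)).
  rewrite big_seq_cond [RHS]big_seq_cond; apply: eq_bigr => q /andP[qs _].
  rewrite -IH //; first 1 last.
  - exact: leq_trans (size_subseq (rem_subseq q s)) sf.
  - exact: rem_uniq.
  - by move=> y /mem_rem ys; apply: RT; rewrite inE ys orbT.
  congr tau; apply/fsetP => a; rewrite !inE.
  have [aR|aR] := boolP (a \in R).
    have -> : (a == place x p) = false.
      by apply: contraTF aR => /eqP ->; rewrite place_left_of.
    have -> // : (a == place x q) = false.
    by apply: contraTF aR => /eqP ->; rewrite place_left_of.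
  have [/imfsetP[/= r rs ->]|aL] := boolP (a \in layer x (p :: s)); last first.
    rewrite andbF; apply/esym/negP => /imfsetP[/= r /mem_rem rs aE].
    by move: aL; rewrite aE place_layer inE rs orbT.
  rewrite /= andbT place_layer !(inj_eq (@place_inj x)) mem_rem_uniq // inE /=.
  move: rs; rewrite inE negb_or; case: eqP => [->|_] /=.
    by rewrite (negPf ps) andbF.
  by move=> ->; rewrite !andbT ?orbF.
have [/andP[p0 pT]|nT] := ifP; last first.
  rewrite big_nil big_seq_cond big1 // => b /andP[bR].
  rewrite adjacentE /= => adj.
  have := RL _ bR; case: b bR adj => u v /= bR adj ux.
  have [p0 [ux' vE]] : p.1 = 0 /\ (u = Posz x /\ v = Posz p.2) by lia.
  move: nT; rewrite p0 eqxx /= -RT; last first.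
    by case: (p) p0 => i j /= ->; rewrite mem_head.
  by rewrite /sq -ux' -vE bR.
have pE : p = (0, p.2) by case: (p) p0 => i j /= /eqP ->.
have aR : sq x p.2 \in R by rewrite RT // -pE mem_head.
have RL' : left_of (R `\ sq x p.2) x.
  by move=> a; rewrite !inE => /andP[_]; exact: RL.
rewrite big_mkcond (big_fsetD1 _ aR) /= [X in (_ + X)%N]big1_fset ?addn0; last first.
  move=> b; rewrite in_fsetD1 => /andP[bn bR] _; case: ifP => //.
  have := RL _ bR; case: b bR bn => u v /= bR bn ux; rewrite adjacentE /= => adj.
  have [ux' vE] : u = Posz x /\ v = Posz p.2 by lia.
  by rewrite /sq -ux' -vE eqxx in bn.
have -> : adjacent (place x p) (sq x p.2).
  by rewrite adjacentE /= (eqP p0); lia.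
have -> : (R `|` layer x (p :: s)) `\` [fset place x p; sq x p.2]
          = (R `\ sq x p.2) `|` layer x s.
  apply/fsetP => a; rewrite !inE.
  have [aR'|aR'] := boolP (a \in R).
    have -> : (a == place x p) = false.
      by apply: contraTF aR' => /eqP ->; rewrite place_left_of.
    rewrite /= !andbT; case: (boolP (a == sq x p.2)) => //= /eqP ->.
    by apply/esym/negP => /imfsetP[/= r _ []]; lia.
  rewrite andbF /=; apply/andP/idP.
    move=> [/norP[ap _] /imfsetP[/= r rs aE]]; rewrite aE place_layer.
    by move: rs ap; rewrite inE aE (inj_eq (@place_inj x)) => /orP[->|].
  move=> /imfsetP[/= r rs ->]; rewrite place_layer inE rs orbT; split=> //.
  rewrite (inj_eq (@place_inj x)) negb_or; apply/andP; split.
    by apply: contraNneq ps => <-.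
  by rewrite /place /sq xpair_eqE; lia.
rewrite (IH (rem p.2 T)) ?rem_uniq //; last first.
  move=> y ys; rewrite !inE mem_rem_uniq // inE /= RT ?inE ?ys ?orbT //.
  by rewrite sq_inj eqxx.
rewrite big_map; apply: eq_bigr => d _; congr tau.
apply/fsetP => a; rewrite !inE.
have -> : (a \in column_cells x (p.2 :: d))
          = (a == sq x p.2) || (a \in column_cells x d).
  apply/imfsetP/orP => /=.
    move=> [y]; rewrite inE => /orP[/eqP -> ->|yd ->]; first by left.
    by right; rewrite in_column.
  move=> [/eqP ->|/imfsetP[/= y yd ->]]; first by exists p.2; rewrite ?mem_head.
  by exists y => //; rewrite inE yd orbT.
by rewrite negb_or; case: (_ == _); case: (_ \in column_cells x d).
Qed.
End Attach.

(** * Ladders whose tilings count to a binary number *)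

(** The rows of the two rails of a ladder; a column that consists of the
    rails only exchanges the two counts of a ladder, the one with and the
    one without its last pair of rail squares. The distance 3 leaves room
    for a rung. *)
Definition rails := [:: 1; 4].
(** Two adjacent columns of this shape contain a 2 x 2 square. It can be
    tiled freely, in two ways, if the rail squares before it are already
    covered, and the dominoes are forced otherwise: the pair of counts (x,
    y) becomes (2x, y). *)
Definition pocket := [:: 0; 1; 4].
(** For the digit 1 the rails are joined by a rung, and the pair of counts
    (x, y) becomes (x + y, x). For the digit 0 it becomes (y, x), and the
    two squares of the rung are spent on an isolated domino instead, so that
    all blocks have the same size. *)
Definition value_rows (b : bool) :=
  if b then [:: 1; 2; 3; 4] else [:: 1; 4; 6; 7].

(** Pocket, plain rails, then the column of the digit: on the counts (k, 1)
    the doubling gives (2k, 1), the exchange (1, 2k), and the last column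
    (2k + b, 1). *)
Definition block (b : bool) : seq (nat * nat) :=
  [seq (3, y) | y <- value_rows b] ++ [seq (2, y) | y <- rails] ++
  [seq (1, y) | y <- pocket] ++ [seq (0, y) | y <- pocket].

(** The least significant digit is rightmost. The ladder starts in column
    [x0] with two separate squares, whose counts are (0, 1). *)
Fixpoint chain (bs : seq bool) (x0 : nat) : seq square :=
  if bs is b :: bs' then
    map (place (x0 + 4 * size bs')) (block b) ++ chain bs' x0
  else [seq sq x0 y | y <- rails].

(** Alternating the rows isolates the dominoes from each other. Neither
    choice contains a rail row, so a pair of rail squares may stand in the
    next column. *)
Definition pad_rows (b : bool) := if b then [:: 2; 3] else [:: 5; 6].

Fixpoint padding (b : bool) (x : nat) : seq square :=
  if x is x'.+1 then
    [seq sq x y | y <- pad_rows b] ++ padding (~~ b) x'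
  else [::].

Definition bits_value : seq bool -> nat :=
  foldr (fun (b : bool) v => b + v.*2) 0.

Local Open Scope fset_scope.

Definition region_of (s : seq square) : region := [fset a in s].

Lemma in_region_of s a : (a \in region_of s) = (a \in s).
Proof. by rewrite in_fset. Qed.

Lemma region_of_cat s t : region_of (s ++ t) = region_of s `|` region_of t.
Proof. by apply/fsetP => a; rewrite in_fsetU !in_region_of mem_cat. Qed.

Lemma region_of_place x s : region_of (map (place x) s) = layer x s.
Proof.
apply/fsetP => a; rewrite in_region_of.
by apply/mapP/imfsetP => /= -[p ps ->]; exists p.
Qed.

Lemma left_of_layer R x s w : left_of R x -> all (fun p => p.1 < w) s ->
  left_of (R `|` layer x s) (x + w).
Proof.
move=> RL /allP sw a; rewrite in_fsetU => /orP[/RL|]; first by lia.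
by move=> /imfsetP[/= p /sw pw ->] /=; lia.
Qed.

Lemma sq_notin_left R x x' y : left_of R x -> x < x' -> (sq x' y \in R) = false.
Proof. by move=> RL xx'; apply/negP => /RL /=; lia. Qed.

Lemma layer_without R x s d : left_of R x ->
  (R `|` layer x s) `\` layer x d = R `|` layer x [seq p <- s | p \notin d].
Proof.
move=> RL; apply/fsetP => a; rewrite !inE.
have [/imfsetP[/= p pd ->]|ad] /= := boolP (a \in layer x d).
  by rewrite place_left_of // place_layer mem_filter pd.
congr (_ || _); apply/imfsetP/imfsetP => /= -[p]; last first.
  by rewrite mem_filter => /andP[_ ps] ->; exists p.
move=> ps aE; exists p => //; rewrite mem_filter ps andbT.
by apply: contra ad => pd; rewrite aE place_layer.
Qed.

Lemma column_cells_layer x i ys :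
  column_cells (x + i.+1) ys = layer x [seq (i, y) | y <- ys].
Proof.
apply/fsetP => a; apply/imfsetP/imfsetP => /= -[u uP ->].
  by exists (i, u) => //; apply/mapP; exists u.
by move: uP => /mapP[y yy ->]; exists y.
Qed.

(** Horner's rule in terms of tilings: the two counts are [tau R] and the
    count without the last rail squares, which stays equal to 1 along a
    ladder. *)
Lemma tau_block R x b : left_of R x ->
  {in pocket, forall y, (sq x y \in R) = (y \in rails)} ->
  (tau (R `|` layer x (block b)) =
    b * tau (R `\` column_cells x rails) + (tau R).*2)%N
  /\ tau ((R `|` layer x (block b)) `\` column_cells (x + 4) rails)
    = tau (R `\` column_cells x rails).
Proof.
move=> RL Rx.
split.
  rewrite (@tau_attach 12 x rails) //; [|by case: b|by case: b|].
    (* boundary_uses evaluates to two ways that leave R untouched and, for the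
       digit 1, one way that uses both rails *)
    case: b; rewrite /= !big_cons big_nil column_cells_nil fsetD0 /=;
      by rewrite ?mul1n ?mul0n -addnn addn0 ?addnA.
  move=> y y0; apply: Rx.
  by move: y0; case: b; rewrite /= !inE !xpair_eqE /=.
rewrite column_cells_layer layer_without //.
rewrite (@tau_attach 12 x rails) //; [|by case: b|by case: b|].
  by case: b => /=; rewrite big_seq1.
move=> y; rewrite mem_filter => /andP[_ y0]; apply: Rx.
by move: y0; case: b; rewrite /= !inE !xpair_eqE /=.
Qed.

(** A ladder to the right of a region [R]; the empty column between them
    makes their tilings independent. *)
Section Chain.
Variables (R : region) (x x0 : nat).
Hypotheses (RL : left_of R x) (xx0 : x.+1 < x0).

Let C bs := R `|` region_of (chain bs x0).

Let C_cons b bs : C (b :: bs) = C bs `|` layer (x0 + 4 * size bs) (block b).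
Proof.
by rewrite /C /= region_of_cat region_of_place -fsetUA [_ `|` layer _ _]fsetUC.
Qed.

Let top_cons (b : bool) bs : (x0 + 4 * size (b :: bs) = x0 + 4 * size bs + 4)%N.
Proof. by rewrite /=; lia. Qed.

Let left_of_C bs : left_of (C bs) (x0 + 4 * size bs).
Proof.
elim: bs => [|b bs IH].
  by move=> a; rewrite in_fsetU in_region_of => /orP[/RL|/mapP[y _ ->]] /=; lia.
by rewrite C_cons top_cons; apply: left_of_layer => //; case: b.
Qed.

Let chain_top bs :
  {in pocket, forall y, (sq (x0 + 4 * size bs) y \in C bs) = (y \in rails)}.
Proof.
case: bs => [|b bs] y yP.
  rewrite muln0 addn0 in_fsetU in_region_of (sq_notin_left _ RL); last by lia.
  by rewrite orFb; apply: (@mem_map _ _ (sq x0)) => i j [].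
rewrite C_cons in_fsetU (sq_notin_left _ (@left_of_C bs)); last by rewrite /=; lia.
have -> : sq (x0 + 4 * size (b :: bs)) y = place (x0 + 4 * size bs) (3, y).
  by congr sq => /=; lia.
by rewrite place_layer; move: yP; rewrite !inE => /or3P[] /eqP ->; case: b.
Qed.

Lemma tau_chain bs : tau R = 1 ->
  tau (R `|` region_of (chain bs x0)) = bits_value bs.
Proof.
move=> tR; suff [] : tau (C bs) = bits_value bs /\
  tau (C bs `\` column_cells (x0 + 4 * size bs) rails) = 1 by [].
elim: bs => [|b bs [IH1 IH2]]; last first.
  have [E1 E2] := tau_block b (@left_of_C bs) (@chain_top bs).
  rewrite C_cons E1 IH1 IH2 muln1; split=> //.
  by rewrite top_cons E2.
have x0E : x0 = (x + (x0 - x.+1).+1)%N by lia.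
have start : C [::] = R `|` layer x [seq (x0 - x.+1, y)%N | y <- rails].
  congr (_ `|` _); rewrite -column_cells_layer -x0E.
  apply/fsetP => a; rewrite in_region_of.
  by apply/mapP/imfsetP => /= -[y yr ->]; exists y.
rewrite start addn0; split.
  rewrite (@tau_attach 2 x [::]) //=.
  - rewrite /nat_adjacent /=; have -> : (x0 - x.+1 == 0)%N = false by lia.
    by rewrite andbF /= big_nil.
  - by rewrite !inE xpair_eqE andbF.
  - by move=> y; rewrite !inE !xpair_eqE; lia.
rewrite x0E column_cells_layer -x0E layer_without //.
set s := [seq _ <- _ | _]; have -> : s = [::].
  rewrite /s; apply/eqP; rewrite -[_ == _]negbK -has_filter.
  by apply/hasPn => p; rewrite negbK.
by rewrite layer_nil fsetU0.
Qed.

End Chain.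

Lemma left_of_padding b x : left_of (region_of (padding b x)) x.
Proof.
elim: x b => [|x IH] b a; rewrite in_region_of //= mem_cat.
move=> /orP[/mapP[y _ ->] //|]; rewrite -in_region_of => /IH; lia.
Qed.

Lemma padding_top b x y :
  (sq x y \in padding b x) -> y \in pad_rows b.
Proof.
case: x => [|x] //=; rewrite mem_cat => /orP[/mapP[z zP [->]] //|].
by rewrite -in_region_of => /left_of_padding /=; lia.
Qed.

Lemma tau_padding b x : tau (region_of (padding b x)) = 1.
Proof.
elim: x b => [|x IH] b.
  have -> : region_of (padding b 0) = fset0.
    by apply/fsetP => a; rewrite in_region_of in_fset0.
  exact: tau_fset0.
rewrite /= region_of_cat fsetUC.
have -> : region_of [seq sq x.+1 y | y <- pad_rows b]
  = layer x [seq (0, y) | y <- pad_rows b].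
  by rewrite -region_of_place /place -map_comp /comp /= addn1.
rewrite (@tau_attach 2 x [::]) //; [|by case: b|by case: b|exact: left_of_padding|].
  have -> : boundary_uses 2 [::] [seq (0, y) | y <- pad_rows b]
     = [:: [::]] by case: b.
  by rewrite big_seq1 column_cells_nil fsetD0 IH.
move=> y ys; rewrite in_region_of in_nil; apply/negP => /padding_top.
by case: b ys; rewrite /= !inE !xpair_eqE; lia.
Qed.

Local Close Scope fset_scope.

(** * Binary digits *)

(** As [encode_nat], but with the empty word for 0. This makes the recursion
    on halves uniform, and lets the machine recognise an exhausted counter
    by a blank. *)
Definition digits (x : nat) : seq bool :=
  if x is 0 then [::]
  else mkseq (fun i => odd (x %/ 2 ^ i)) (trunc_log 2 x).+1.

Lemma encode_nat_digits x : 0 < x -> encode_nat x = map Bit (digits x).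
Proof. by case: x => // x _; rewrite /encode_nat /digits /mkseq -map_comp. Qed.

Lemma digitsE x : 0 < x -> digits x = odd x :: digits x./2.
Proof.
case: x => [|[|x]] // _; set y := x.+2.
have y2 : 0 < y./2 by rewrite half_gt0.
have -> : digits y./2 =
    mkseq (fun i => odd (y./2 %/ 2 ^ i)) (trunc_log 2 y./2).+1.
  by rewrite /digits; case: (y./2) y2.
rewrite /digits -/y trunc_log2S // /mkseq.
move: (trunc_log 2 y./2).+1 => t /=; rewrite divn1.
congr cons; rewrite (iotaDl 1 0) -map_comp; apply: eq_map => i /=.
by rewrite add1n expnS divnMA divn2.
Qed.

Lemma bits_value_digits x : bits_value (digits x) = x.
Proof.
elim/ltn_ind: x => [[|x] IH] //; rewrite digitsE //= IH; last by lia.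
exact: (odd_double_half x.+1).
Qed.

Lemma size_digits_le x : size (digits x) <= x.
Proof.
elim/ltn_ind: x => [[|x] IH] //; rewrite digitsE //=.
by rewrite ltnS; apply: leq_trans (IH _ _) _; lia.
Qed.

Lemma exp2_size_digits x : 0 < x -> 2 ^ (size (digits x)).-1 <= x.
Proof. by case: x => // x _; rewrite /digits size_mkseq trunc_logP. Qed.

Lemma encode_square_sq x y : 0 < x -> encode_square (sq x y)
  = map Bit (digits x) ++ Sep :: encode_nat y ++ [:: Sep].
Proof. by move=> x0; rewrite -encode_nat_digits. Qed.

Lemma size_encode_row y : y < 8 -> size (encode_nat y) <= 3.
Proof. by do 8!case: y => [|y] //. Qed.

(** * The region for a pair of numbers *)

(** A digit costs 12 squares but only 4 columns, hence [2 * m] columns are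
    left empty after the ladder and the rest is filled with one domino per
    column. For [k = 0] and [k = 1] no block is used, so that every [n > 0]
    is large enough. *)
Definition layout (n k : nat) : seq square :=
  if k == 0 then [seq sq n y | y <- rails] ++ padding true n.-1
  else if k == 1 then padding true n
  else let m := size (digits k) in
    chain (digits k) (n - 4 * m) ++ padding true (n - 6 * m - 1).

Arguments digits : simpl never.

Lemma layout0 n :
  layout n 0 = [seq sq n y | y <- rails] ++ padding true n.-1.
Proof. by []. Qed.

Lemma layout_gt1 n k : 1 < k ->
  layout n k = chain (digits k) (n - 4 * size (digits k))
               ++ padding true (n - 6 * size (digits k) - 1).
Proof. by case: k => [|[|k]]. Qed.

(** The room that the ladder of [k] needs. *)
Definition roomy n k := (1 < k) ==> (6 * size (digits k) < n).

Lemma chain_bounds bs x0 a : a \in chain bs x0 ->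
  (x0%:Z <= a.1 <= (x0 + 4 * size bs)%N%:Z)%R.
Proof.
elim: bs => [|b bs IH]; first by move=> /mapP[y _ ->] /=; lia.
rewrite /= mem_cat => /orP[/mapP[p pb ->]|/IH /=]; last by lia.
have: p.1 < 4 by move: p pb; apply/allP; case: b.
by rewrite /=; lia.
Qed.

Lemma size_padding b x : size (padding b x) = 2 * x.
Proof.
elim: x b => [|x IH] b //=; rewrite size_cat IH size_map.
by case: b => /=; lia.
Qed.

Lemma size_chain bs x0 : size (chain bs x0) = 2 * (6 * size bs).+1.
Proof.
elim: bs => [|b bs IH] //=; rewrite size_cat IH size_map.
by case: b => /=; lia.
Qed.

Lemma sq_row_inj x : injective (sq x).
Proof. by move=> y z []. Qed.

Lemma uniq_padding b x : uniq (padding b x).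
Proof.
elim: x b => [|x IH] b //; rewrite [padding _ _]/= cat_uniq IH andbT.
rewrite map_inj_uniq; last exact: sq_row_inj.
apply/andP; split; first by case: b.
apply/hasPn => a; rewrite -in_region_of => /left_of_padding ax.
by apply/negP => /mapP[y _ aE]; rewrite aE /= in ax; lia.
Qed.

Lemma uniq_chain bs x0 : uniq (chain bs x0).
Proof.
elim: bs => [|b bs IH]; first by rewrite map_inj_uniq //; exact: sq_row_inj.
rewrite -[chain _ _]/(map (place _) (block b) ++ chain bs x0) cat_uniq IH andbT.
rewrite map_inj_uniq; last exact: place_inj.
apply/andP; split; first by case: b.
apply/hasPn => a /chain_bounds abd.
by apply/negP => /mapP[p _ aE]; rewrite aE /= in abd; lia.
Qed.

Lemma size_layout n k : 0 < n -> roomy n k -> size (layout n k) = 2 * n.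
Proof.
move=> n0; rewrite /roomy; case: k => [|[|k]] rk.
- by rewrite layout0 size_cat size_map size_padding /=; lia.
- by rewrite size_padding.
- by rewrite layout_gt1 // size_cat size_chain size_padding; move: rk; lia.
Qed.

Lemma uniq_layout n k : 0 < n -> roomy n k -> uniq (layout n k).
Proof.
move=> n0; rewrite /roomy; case: k => [|[|k]] rk.
- rewrite layout0 cat_uniq uniq_padding andbT; apply/andP; split.
    by rewrite map_inj_uniq //; exact: sq_row_inj.
  apply/hasPn => a; rewrite -in_region_of => /left_of_padding ax.
  by apply/negP => /mapP[y _ aE]; rewrite aE /= in ax; lia.
- exact: uniq_padding.
- have {rk}: 6 * size (digits k.+2) < n := rk.
  rewrite layout_gt1 //; move: (digits _) => bs rk.
  rewrite cat_uniq uniq_padding andbT uniq_chain /=.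
  apply/hasPn => a; rewrite -in_region_of => /left_of_padding ax.
  apply/negP => ac; have := chain_bounds ac.
  by case: a ax {ac} => u v /=; lia.
Qed.

Lemma tau_layout n k : 0 < n -> roomy n k -> tau (region_of (layout n k)) = k.
Proof.
move=> n0; rewrite /roomy; case: k => [|[|k]] rk.
- rewrite layout0 region_of_cat fsetUC.
  have -> : region_of [seq sq n y | y <- rails]
    = layer n.-1 [seq (0, y) | y <- rails].
    by rewrite -region_of_place /place -map_comp /comp /= addn1 prednK.
  rewrite (@tau_attach 2 n.-1 [::]) ?big_nil //; first exact: left_of_padding.
  move=> y ys; rewrite in_region_of in_nil; apply/negP => /padding_top.
  by move: ys; rewrite /= !inE !xpair_eqE; lia.
- exact: tau_padding.
- have {}rk : 6 * size (digits k.+2) < n := rk.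
  rewrite layout_gt1 // region_of_cat fsetUC.
  rewrite (tau_chain (@left_of_padding _ _)) ?tau_padding ?bits_value_digits //.
by have : 0 < size (digits k.+2); [rewrite digitsE | lia].
Qed.

Lemma card_layout n k : 0 < n -> roomy n k ->
  #|` region_of (layout n k)| = 2 * n.
Proof.
by move=> n0 rk; rewrite card_fseq undup_id ?size_layout ?uniq_layout.
Qed.

Lemma perm_layout n k : 0 < n -> roomy n k ->
  perm_eq (layout n k) (enum_fset (region_of (layout n k))).
Proof.
move=> n0 rk; apply: uniq_perm; rewrite ?uniq_layout ?fset_uniq //.
by move=> a; rewrite in_fset.
Qed.

(** * The Turing machine *)

(** The control state of the machine is the code that remains to be
    executed. Tape 0 holds the input, tape 1 a counter, namely the current
    column in binary, and tape 2 receives the output. An instruction that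
    stands for a loop stays at the head of the code until its loop ends.
    - [Load] copies the first number to the counter, [Rewind] brings the
      head of the counter back to its first digit.
    - [ReadFirst] and [First] treat one-digit second numbers apart,
      [ReadBit] emits the block of the next digit, [SkipBit] goes back over
      the digits and decrements the counter twice for each, [Pad] emits the
      isolated dominoes.
    - [Copy] prints the counter, [Put] prints a symbol.
    - [Borrow], [Trim] and [Erase] decrement the counter: 0s become 1s up to
      the first 1, which becomes 0 and is erased if it was the leading
      digit.
    - [RewindOut] brings the head of the output back to its beginning. *)
Inductive instr : Type :=
| Load | Rewind | ReadFirst | First of bool | ReadBit | SkipBit
| Pad of bool | Copy | Put of symbol | Borrow | Trim | Erase | RewindOut.

Definition instr_code (i : instr) : symbol + bool + bool + 'I_10 :=
  match i with
  | Put s => inl (inl (inl s)) | First b => inl (inl (inr b))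
  | Pad b => inl (inr b)
  | Load => inr (inord 0) | Rewind => inr (inord 1)
  | ReadFirst => inr (inord 2) | ReadBit => inr (inord 3)
  | SkipBit => inr (inord 4) | Copy => inr (inord 5) | Borrow => inr (inord 6)
  | Trim => inr (inord 7) | Erase => inr (inord 8) | RewindOut => inr (inord 9)
  end.

Definition instr_decode (c : symbol + bool + bool + 'I_10) : instr :=
  match c with
  | inl (inl (inl s)) => Put s | inl (inl (inr b)) => First b
  | inl (inr b) => Pad b
  | inr i => nth Load [:: Load; Rewind; ReadFirst; ReadBit; SkipBit; Copy;
                          Borrow; Trim; Erase; RewindOut] i
  end.

Lemma instr_codeK : cancel instr_code instr_decode.
Proof. by case=> //=; rewrite inordK. Qed.

HB.instance Definition _ := Finite.copy instr (can_type instr_codeK).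

(** The codes take the code to be executed after them as an argument. *)
Definition square_code (y : nat) (c : seq instr) : seq instr :=
  [:: Copy, Rewind & map Put (Sep :: encode_nat y ++ [:: Sep]) ++ c].

Definition decrement_code (c : seq instr) : seq instr :=
  [:: Borrow, Trim, Rewind & c].

Definition column_code (ys : seq nat) (c : seq instr) : seq instr :=
  foldr square_code (decrement_code c) ys.

Definition block_code (b : bool) (c : seq instr) : seq instr :=
  column_code (value_rows b) (column_code rails (column_code pocket (column_code pocket c))).

(** [None] leaves a tape as it is. *)
Definition action := option (option symbol * move).

Definition transition (c : seq instr) (h0 h1 h2 : option symbol) :
    seq instr * seq action :=
  let only0 c' m := (c', [:: Some (h0, m)]) in
  let only1 c' w m := (c', [:: None; Some (w, m)]) in
  let only2 c' w m := (c', [:: None; None; Some (w, m)]) in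
  match c with
  | [::] => ([::], [::])
  | i :: c' =>
    match i with
    | Load => if h0 is Some (Bit b)
              then (c, [:: Some (h0, MoveRight); Some (h0, MoveRight)])
              else (c', [:: Some (h0, MoveRight); Some (h1, MoveLeft)])
    | Rewind => if h1 then only1 c h1 MoveLeft else only1 c' h1 MoveRight
    | ReadFirst => if h0 is Some (Bit b) then only0 [:: First b] MoveRight
                   else ([::], [::])
    | First b => if h0 then only0 [:: ReadBit] MoveLeft
                 else (if b then [:: Pad true]
                       else column_code rails [:: Pad true], [::])
    | ReadBit => if h0 is Some (Bit b)
                 then only0 (block_code b [:: ReadBit]) MoveRight
                 else only0 (column_code rails [:: SkipBit]) MoveLeft
    | SkipBit => if h0 is Some (Bit b)
                 then only0 (decrement_code (decrement_code [:: SkipBit])) MoveLeft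
                 else ([:: Pad true], [::])
    | Pad b => if h1 then (column_code (pad_rows b) [:: Pad (~~ b)], [::])
               else only2 [:: RewindOut] h2 MoveLeft
    | Copy => if h1
              then (c, [:: None; Some (h1, MoveRight); Some (h1, MoveRight)])
              else only1 c' h1 MoveLeft
    | Put s => only2 c' (Some s) MoveRight
    | Borrow => if h1 is Some (Bit false)
                then only1 c (Some (Bit true)) MoveRight
                else only1 c' (Some (Bit false)) MoveRight
    | Trim => if h1 then only1 c' h1 MoveLeft
              else only1 (Erase :: c') h1 MoveLeft
    | Erase => only1 c' None MoveLeft
    | RewindOut => if h2 then only2 c h2 MoveLeft else only2 c' h2 MoveRight
    end
  end.

(** Large enough for every code that an instruction loads, so that the
    states form a finite type. *)
Definition code_cap := 128.

Lemma size_transition c h0 h1 h2 :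
  size c <= code_cap -> size (transition c h0 h1 h2).1 <= code_cap.
Proof.
case: c => [|i c] //; rewrite [size (i :: c)]/= => sc.
have loads : all (fun c' => size c' <= code_cap)
    [:: block_code true [:: ReadBit]; block_code false [:: ReadBit];
        column_code rails [:: SkipBit]; column_code rails [:: Pad true];
        column_code (pad_rows true) [:: Pad false];
        column_code (pad_rows false) [:: Pad true]] by vm_compute.
have [l1 l2 l3 l4 /and3P[l5 l6 _]] := and5P loads.
by case: i => [|||[]||| []||s||||] /=; case: h0 => [[[]||]|];
   case: h1 => [[[]||]|]; case: h2 => [?|] //=; apply: ltnW.
Qed.

Definition machine : turing_machine :=
  @TuringMachine (code_cap.-bseq instr) void 2
    (insub_bseq code_cap [:: Load; Rewind; ReadFirst])
    (fun q => nilp q)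
    (fun q h =>
       let sym (i : 'I_3) :=
         obind (fun a => if a is inl s then Some s else None) (h i) in
       let: (c, acts) := transition q (sym ord0) (sym (inord 1)) (sym ord_max) in
       (insub_bseq code_cap c,
        [ffun i : 'I_3 => if nth None acts i is Some (w, m)
                          then (omap inl w, m) else (h i, Stay)])).

(** * Simulation up to blanks *)

(** A tape is described by a pair of words: the cells to the left of its
    head, nearest first, and the cells from its head on. *)
Definition word := seq (option symbol).

Definition snapshot :=
  (seq instr * (word * word) * (word * word) * (word * word))%type.

(** Equality of one-way infinite tapes that are blank beyond the listed
    cells: moves to and fro leave blanks at the ends of the lists. *)
Definition blank_eq A (s s' : seq (option A)) :=
  forall i, nth None s i = nth None s' i.

Definition holds (t : tape (symbol + void)) (T : word * word) :=
  blank_eq (tleft t) (map (omap inl) T.1) /\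
  blank_eq (Defs.thead t :: tright t) (map (omap inl) T.2).

Definition apply_action (a : action) (T : word * word) : word * word :=
  match a with
  | Some (w, MoveLeft) => (behead T.1, head None T.1 :: w :: behead T.2)
  | Some (w, MoveRight) => (w :: T.1, behead T.2)
  | Some (w, Stay) => (T.1, w :: behead T.2)
  | None => T
  end.

Lemma blank_eq_head A (s s' : seq (option A)) :
  blank_eq s s' -> head None s = head None s'.
Proof. by move=> /(_ 0); rewrite !nth0. Qed.

Lemma blank_eq_behead A (s s' : seq (option A)) :
  blank_eq s s' -> blank_eq (behead s) (behead s').
Proof. by move=> e i; rewrite !nth_behead. Qed.

Lemma blank_eq_cons A (a : option A) s s' :
  blank_eq s s' -> blank_eq (a :: s) (a :: s').
Proof. by move=> e [|i] //=. Qed.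

Lemma holds_head t T : holds t T -> Defs.thead t = omap inl (head None T.2).
Proof. by case=> _ /blank_eq_head /= ->; case: T.2. Qed.

Lemma holds_action t T w m : holds t T ->
  holds (tape_move m (tape_write (omap inl w) t)) (apply_action (Some (w, m)) T).
Proof.
case: t T => l h r [L R] [/= hl hr].
have hb : blank_eq r (map (omap inl) (behead R)).
  by rewrite -behead_map; exact: (blank_eq_behead hr).
case: m; split=> //=.
- by rewrite -behead_map; exact: blank_eq_behead.
- rewrite (blank_eq_head hl); case: (L) => [|a L']; by do 2!apply: blank_eq_cons.
- exact: blank_eq_cons.
- by move=> i; rewrite -hb; case: (r) i => [|a r'] [|[|i]].
- exact: blank_eq_cons.
Qed.

Lemma holds_stay t T : holds t T ->
  holds (tape_move Stay (tape_write (Defs.thead t) t)) T.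
Proof. by case: t. Qed.

Definition sim (c : config machine) (s : snapshot) : Prop :=
  let: (code, T0, T1, T2) := s in
  [/\ bseqval (cstate c) = code, holds (ctapes c ord0) T0,
      holds (ctapes c (inord 1)) T1 & holds (ctapes c ord_max) T2].

Definition snapshot_step (s : snapshot) : snapshot :=
  let: (code, T0, T1, T2) := s in
  let: (c, a) :=
    transition code (head None T0.2) (head None T1.2) (head None T2.2) in
  let n := nth None a in
  (c, apply_action (n 0) T0, apply_action (n 1) T1, apply_action (n 2) T2).

(** The concrete machine can be replaced by computations on snapshots, whose
    code is an ordinary list. *)
Lemma sim_step c s : s.1.1.1 != [::] -> sim c s -> sim (step c) (snapshot_step s).
Proof.
case: s => [[[code T0] T1] T2] /= cn [cE h0 h1 h2].
rewrite /step /= /nilp -[size _]/(size (bseqval (cstate c))) cE size_eq0 (negPf cn).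
rewrite !ffunE (holds_head h0) (holds_head h1) (holds_head h2).
have symK h :
    obind (fun a : symbol + void => if a is inl s then Some s else None)
          (omap inl h) = h by case: h.
rewrite !symK; set h := (head None T0.2, head None T1.2, head None T2.2).
have : size (transition code h.1.1 h.1.2 h.2).1 <= code_cap.
  by apply: size_transition; rewrite -cE size_bseq.
rewrite /h /=; case: transition => c' a /= sc'.
split; rewrite /= ?ffunE /=.
- by rewrite /insub_bseq val_insubd sc'.
- by case: nth => [[w m]|]; [apply: holds_action | apply: holds_stay].
- by rewrite inordK //=; case: nth => [[w m]|]; [apply: holds_action | apply: holds_stay].
- by case: nth => [[w m]|]; [apply: holds_action | apply: holds_stay].
Qed.

Definition blank_eq2 (T T' : word * word) :=
  blank_eq T.1 T'.1 /\ blank_eq T.2 T'.2.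

(** The number of steps is only bounded from above, so that no routine needs
    its exact running time. *)
Definition reach (s s' : snapshot) (t : nat) : Prop :=
  forall c, sim c s -> exists2 t', t' <= t & sim (iter t' (@step machine) c) s'.

Lemma reach_refl s : reach s s 0.
Proof. by move=> c sc; exists 0. Qed.

Lemma reach_trans s' s s'' t t' :
  reach s s' t -> reach s' s'' t' -> reach s s'' (t + t').
Proof.
move=> st st' c /st[u ut /st'[u' ut' sc]]; exists (u' + u); first by lia.
by rewrite iterD.
Qed.

Lemma reach_leq s s' t t' : reach s s' t -> t <= t' -> reach s s' t'.
Proof.
by move=> st tt' c /st[u ut sc]; exists u => //; apply: leq_trans tt'.
Qed.

Lemma reach_step s s' t :
  s.1.1.1 != [::] -> reach (snapshot_step s) s' t -> reach s s' t.+1.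
Proof.
move=> cn st c sc; have [u ut su] := st _ (sim_step cn sc).
by exists u.+1; rewrite ?ltnS // iterSr.
Qed.

Lemma blank_eq_map A B (f : A -> B) (s s' : seq (option A)) :
  blank_eq s s' -> blank_eq (map (omap f) s) (map (omap f) s').
Proof.
move=> e i.
have nthE (u : seq (option A)) :
    nth None (map (omap f) u) i = omap f (nth None u i).
  by elim: u i {e} => [|a u IH] [|i] //=.
by rewrite !nthE e.
Qed.

Lemma reach_blank code (T0 T1 T2 T1' : word * word) :
  blank_eq2 T1 T1' -> reach (code, T0, T1, T2) (code, T0, T1', T2) 0.
Proof.
case=> e1 e2 c [cE h0 [h1 h1'] h2]; exists 0 => //; split=> //; split.
  by move=> i; rewrite h1; apply: blank_eq_map.
by move=> i; rewrite h1'; apply: blank_eq_map.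
Qed.

(** * Running the machine *)

Definition cells (w : seq symbol) : word := map Some w.
Definition bit_cells (D : seq bool) : word := cells (map Bit D).
Definition printed (w : seq symbol) : word * word := (rev (cells w), [::]).
(** The tape after one move to the left. A loop that runs over a word to the
    right stops at the blank after it and steps back, which leaves a tape of
    this form; the loop that rewinds preserves the form. *)
Definition moved_left (T : word * word) : word * word :=
  (behead T.1, head None T.1 :: T.2).

Lemma printed_rcons w s : printed (rcons w s) = (Some s :: (printed w).1, [::]).
Proof. by rewrite /printed /cells map_rcons rev_rcons. Qed.

Lemma blank_eq_nones A (s : seq (option A)) n : blank_eq (s ++ nseq n None) s.
Proof.
move=> i; rewrite nth_cat; case: ltnP => // si.
by rewrite [RHS]nth_default // nth_nseq if_same.
Qed.

Lemma reach_nones code T0 L R n T2 :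
  reach (code, T0, (L, R ++ nseq n None), T2) (code, T0, (L, R), T2) 0.
Proof. by apply: reach_blank; split=> //; exact: blank_eq_nones. Qed.

Section Routines.
Variables (c : seq instr).

(** The loop passes the first digit and returns from the blank before it. *)
Lemma run_rewind T0 T2 A R :
  reach (Rewind :: c, T0, moved_left (cells A, R), T2)
        (c, T0, ([::], cells (rev A) ++ R), T2) (size A).+1.
Proof.
elim: A R => [|a A IH] R; apply: reach_step => //=.
  by apply: reach_blank; split=> //; exact: (@blank_eq_nones _ [::] 1).
by rewrite rev_cons /cells map_rcons cat_rcons; exact: IH.
Qed.

Lemma run_rewind_out T0 T1 A R :
  reach (RewindOut :: c, T0, T1, moved_left (cells A, R))
        (c, T0, T1, ([::], cells (rev A) ++ R)) (size A).+1.
Proof.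
elim: A R => [|a A IH] R; apply: reach_step => //=.
  move=> k [cE h0 h1 [h2 h2']]; exists 0 => //; split=> //; split=> //.
  by move=> i; rewrite h2; case: i => [|[|i]].
by rewrite rev_cons /cells map_rcons cat_rcons; exact: IH.
Qed.

Lemma run_copy T0 A D w :
  reach (Copy :: c, T0, (cells A, cells D), printed w)
        (c, T0, moved_left (cells (rev D ++ A), [:: None]), printed (w ++ D))
        (size D).+1.
Proof.
elim: D A w => [|d D IH] A w; apply: reach_step => //=.
  by rewrite cats0; exact: reach_refl.
rewrite rev_cons cat_rcons -[w ++ _]cat_rcons.
have := IH (d :: A) (rcons w d); rewrite printed_rcons. exact.
Qed.

Lemma run_put T0 T1 u w :
  reach (map Put u ++ c, T0, T1, printed w)
        (c, T0, T1, printed (w ++ u)) (size u).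
Proof.
elim: u w => [|s u IH] w; first by rewrite cats0; exact: reach_refl.
apply: reach_step => //=; rewrite -cat_rcons.
by have := IH (rcons w s); rewrite printed_rcons.
Qed.

End Routines.

Lemma run_square c T0 x y w : 0 < x -> y < 8 ->
  reach (square_code y c, T0, ([::], bit_cells (digits x)), printed w)
        (c, T0, ([::], bit_cells (digits x)),
         printed (w ++ encode_square (sq x y)))
        (2 * x + 12).
Proof.
move=> x0 y8; rewrite encode_square_sq //.
set D := map Bit (digits x).
have sD : size D <= x by rewrite size_map size_digits_le.
have sy := size_encode_row y8.
rewrite /square_code; set u := Sep :: _.
have r1 := @run_copy (Rewind :: map Put u ++ c) T0 [::] D w.
have r2 := @run_rewind (map Put u ++ c) T0 (printed (w ++ D)) (rev D) [:: None].
have r3 := @reach_nones (map Put u ++ c) T0 [::] (cells D) 1 (printed (w ++ D)).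
have r4 := @run_put c T0 ([::], cells D) u (w ++ D).
rewrite cats0 in r1; rewrite revK in r2; rewrite -catA in r4.
apply: reach_leq (reach_trans r1 (reach_trans r2 (reach_trans r3 r4))) _.
rewrite size_rev /u -cat1s !size_cat.
by move: (size _) (size _) sD sy => d e /=; lia.
Qed.

(** The effect of borrowing on digits, least significant first. *)
Fixpoint decrement (D : seq bool) : seq bool :=
  match D with
  | [::] | [:: true] => [::]
  | true :: D' => false :: D'
  | false :: D' => true :: decrement D'
  end.

Lemma decrement_digits x : 0 < x -> decrement (digits x) = digits x.-1.
Proof.
elim/ltn_ind: x => x IH x0; rewrite digitsE //.
have [ox|ex] := boolP (odd x); last first.
  have xE : x = (x./2).*2 by have := odd_double_half x; rewrite (negPf ex).
  rewrite /= IH; [|lia|lia]; rewrite [RHS]digitsE; last by lia.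
  by congr cons; [lia|congr digits; lia].
have [x1|x1] := ltnP 1 x; last by have -> : x = 1 by lia.
rewrite [RHS]digitsE; last by lia.
have -> : odd x.-1 = false by lia.
have -> : x.-1./2 = x./2 by lia.
by rewrite /= [digits x./2]digitsE //; lia.
Qed.

Lemma has_one_digits x : 0 < x -> has id (digits x).
Proof.
elim/ltn_ind: x => x IH x0; rewrite digitsE //=.
by have [//|ex] := boolP (odd x); apply: IH; lia.
Qed.

(** Induction on the digits still to be scanned; [A] collects those already
    passed. [Trim] turns into [Erase] exactly when the digit 1 that was
    changed was the leading one. *)
Lemma run_borrow c T0 T2 A D : has id D ->
  reach (decrement_code c, T0, (bit_cells A, bit_cells D), T2)
        (c, T0, ([::], bit_cells (rev A ++ decrement D)), T2)
        (size A + 2 * size D + 3).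
Proof.
have bitsE (u v : seq bool) : bit_cells (u ++ v) = bit_cells u ++ bit_cells v.
  by rewrite /bit_cells /cells !map_cat.
elim: D A => [|[] D IH] A //= hD; last first.
  have -> : size A + 2 * (size D).+1 + 3 = (size (true :: A) + 2 * size D + 3).+1.
    by rewrite /=; lia.
  apply: reach_step => //=.
  by have := IH (true :: A) hD; rewrite rev_cons cat_rcons.
have -> : size A + 2 * (size D).+1 + 3 = (size A + 2 * size D + 3).+2 by lia.
apply: reach_step => //=; apply: reach_step => //.
case: D {IH hD} => [|d D] /=.
  rewrite addnS addn0 addnC; apply: reach_step => //=.
  have := @run_rewind c T0 T2 (map Bit A) [:: None; None].
  rewrite -map_rev size_map cats0 => r.
  apply: reach_leq (reach_trans r (@reach_nones c T0 [::] _ 2 T2)) _.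
  by lia.
have := @run_rewind c T0 T2 (map Bit (false :: A)) (bit_cells (d :: D)).
rewrite -map_rev rev_cons -[cells _]/(bit_cells _) -bitsE cat_rcons => r.
by apply: reach_leq r _; rewrite size_map /=; lia.
Qed.

Lemma run_decrement c T0 T2 x : 0 < x ->
  reach (decrement_code c, T0, ([::], bit_cells (digits x)), T2)
        (c, T0, ([::], bit_cells (digits x.-1)), T2) (2 * x + 3).
Proof.
move=> x0; rewrite -decrement_digits //.
apply: (reach_leq (@run_borrow c T0 T2 [::] _ (has_one_digits x0))).
by have := size_digits_le x; rewrite /=; lia.
Qed.

Lemma encode_squares_cat s t :
  encode_squares (s ++ t) = encode_squares s ++ encode_squares t.
Proof. by rewrite /encode_squares map_cat flatten_cat. Qed.

Arguments column_code : simpl never.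
Arguments decrement_code : simpl never.
Arguments encode_squares : simpl never.

Lemma run_column c T0 x ys w : 0 < x -> all (fun y => y < 8) ys ->
  reach (column_code ys c, T0, ([::], bit_cells (digits x)), printed w)
        (c, T0, ([::], bit_cells (digits x.-1)),
         printed (w ++ encode_squares [seq sq x y | y <- ys]))
        ((size ys).+1 * (2 * x + 12)).
Proof.
move=> x0; elim: ys w => [|y ys IH] w.
  move=> _; rewrite cats0.
  by apply: reach_leq (@run_decrement c T0 (printed w) _ x0) _; lia.
move=> /andP[y8 ys8].
have r1 := @run_square (column_code ys c) T0 x y w x0 y8.
have r2 := IH (w ++ encode_square (sq x y)) ys8.
rewrite -catA in r2; rewrite [size _]/= mulSn.
exact: reach_trans r1 r2.
Qed.

Lemma run_block b c T0 x w :
  reach (block_code b c, T0, ([::], bit_cells (digits (x + 4))), printed w)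
        (c, T0, ([::], bit_cells (digits x)),
         printed (w ++ encode_squares (map (place x) (block b))))
        (16 * (2 * (x + 4) + 12)).
Proof.
have -> : map (place x) (block b) =
    [seq sq x.+4 y | y <- value_rows b] ++ [seq sq x.+3 y | y <- rails] ++
    [seq sq x.+2 y | y <- pocket] ++ [seq sq x.+1 y | y <- pocket].
  by rewrite /block !map_cat -!map_comp /comp /place /= !addnS addn0.
rewrite !encode_squares_cat !addnS addn0.
have r8 : all (fun y => y < 8) (value_rows b) by case: (b).
pose c3 := column_code pocket c; pose c2 := column_code pocket c3.
have r1 := @run_column (column_code rails c2) T0 x.+4 _ w isT r8.
have r2 w' := @run_column c2 T0 x.+3 rails w' isT isT.
have r3 w' := @run_column c3 T0 x.+2 pocket w' isT isT.
have r4 w' := @run_column c T0 x.+1 pocket w' isT isT.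
have r := reach_trans r1 (reach_trans (r2 _) (reach_trans (r3 _) (r4 _))).
rewrite -3!catA in r; apply: reach_leq r _.
by have -> : size (value_rows b) = 4 by [case: (b)]; rewrite /=; lia.
Qed.

(** The digits are met in the order in which [chain] lists its blocks,
    because both start with the least significant one. *)
Lemma run_bits bs A Z x0 w N : 0 < x0 -> x0 + 4 * size bs <= N ->
  reach ([:: ReadBit], (bit_cells A ++ Z, bit_cells bs),
         ([::], bit_cells (digits (x0 + 4 * size bs))), printed w)
        ([:: SkipBit], moved_left (bit_cells (rev bs ++ A) ++ Z, [:: None]),
         ([::], bit_cells (digits x0.-1)), printed (w ++ encode_squares (chain bs x0)))
        ((size bs).+1 * (16 * (2 * N + 12) + 1)).
Proof.
move=> x0_gt0; elim: bs A w => [|b bs IH] A w sN.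
  rewrite muln0 addn0 in sN *; rewrite mul1n addn1.
  apply: reach_step => //.
  by apply: reach_leq (@run_column _ _ _ rails w x0_gt0 _) _ => //; rewrite /=; lia.
rewrite [size _]/= mulSn addn1 addSn; apply: reach_step => //.
have -> : x0 + 4 * (size bs).+1 = x0 + 4 * size bs + 4 by lia.
rewrite [size _]/= in sN.
have sN' : x0 + 4 * size bs <= N by lia.
have r1 := @run_block b [:: ReadBit]
  (bit_cells (b :: A) ++ Z, bit_cells bs) (x0 + 4 * size bs) w.
have r2 := IH (b :: A)
  (w ++ encode_squares (map (place (x0 + 4 * size bs)) (block b))) sN'.
rewrite -catA -encode_squares_cat addn1 in r2; rewrite rev_cons cat_rcons.
by apply: reach_leq (reach_trans r1 r2) _; rewrite leq_add2r; lia.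
Qed.

(** The two empty columns that each digit owes are paid on the way back to
    the separator. *)
Lemma run_skip A Z R x T2 N : 2 * size A <= x <= N ->
  exists R',
    reach ([:: SkipBit], moved_left (bit_cells A ++ Some Sep :: Z, R),
           ([::], bit_cells (digits x)), T2)
          ([:: Pad true], (Z, Some Sep :: R'),
           ([::], bit_cells (digits (x - 2 * size A))), T2)
          ((size A).+1 * (4 * N + 7)).
Proof.
elim: A R x => [|a A IH] R x xN.
  exists R; rewrite muln0 subn0; apply: (@reach_leq _ _ 1); last by lia.
  by apply: reach_step => //; exact: reach_refl.
rewrite [size _]/= in xN *.
have xN' : 2 * size A <= x.-2 <= N by lia.
have [R' r3] := IH (Some (Bit a) :: R) _ xN'; exists R'.
pose T0 := moved_left (bit_cells A ++ Some Sep :: Z, Some (Bit a) :: R).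
have r1 := @run_decrement (decrement_code [:: SkipBit]) T0 T2 x.
have r2 := @run_decrement [:: SkipBit] T0 T2 x.-1.
have r := reach_trans (r1 _) (reach_trans (r2 _) r3).
apply: (@reach_leq _ _
  ((2 * x + 3) + ((2 * x.-1 + 3) + (size A).+1 * (4 * N + 7))).+1);
  last by lia.
apply: reach_step => //.
have -> : x - 2 * (size A).+1 = x.-2 - 2 * size A by lia.
by apply: r; lia.
Qed.

Lemma run_pad b x T0 w N : x <= N ->
  reach ([:: Pad b], T0, ([::], bit_cells (digits x)), printed w)
        ([:: RewindOut], T0, ([::], [::]),
         moved_left (rev (cells (w ++ encode_squares (padding b x))), [:: None]))
        (x * (3 * (2 * N + 12) + 1) + 1).
Proof.
elim: x b w => [|x IH] b w xN.
  by apply: reach_step => //; rewrite cats0; exact: reach_refl.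
apply: (@reach_leq _ _
  (3 * (2 * N + 12) + (x * (3 * (2 * N + 12) + 1) + 1)).+1); last by lia.
apply: reach_step => //.
have r1 := @run_column [:: Pad (~~ b)] T0 x.+1 (pad_rows b) w isT.
have r2 := IH (~~ b)
  (w ++ encode_squares [seq sq x.+1 y | y <- pad_rows b]) (ltnW xN).
rewrite -catA -encode_squares_cat in r2.
have r := reach_trans (r1 _) r2.
apply: reach_leq (r _) _; first by case: (b).
have -> : size (pad_rows b) = 2 by case: (b).
by lia.
Qed.

Lemma run_finish T0 T1 w :
  reach ([:: RewindOut], T0, T1, moved_left (rev (cells w), [:: None]))
        ([::], T0, T1, ([::], cells w ++ [:: None])) (size w).+1.
Proof.
have := @run_rewind_out [::] T0 T1 (rev w) [:: None].
by rewrite revK size_rev /cells map_rev.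
Qed.

Lemma run_load A D Z B T2 :
  reach ([:: Load; Rewind; ReadFirst],
         (bit_cells A, bit_cells D ++ Some Sep :: Z), (bit_cells B, [::]), T2)
        ([:: Rewind; ReadFirst], (Some Sep :: bit_cells (rev D ++ A), Z),
         moved_left (bit_cells (rev D ++ B), [:: None]), T2) (size D).+1.
Proof.
elim: D A B => [|d D IH] A B; apply: reach_step => //.
  exact: reach_refl.
rewrite rev_cons !cat_rcons; exact: (IH (d :: A) (d :: B)).
Qed.

Lemma run_init n k T2 : 0 < n ->
  reach ([:: Load; Rewind; ReadFirst], ([::], cells (encode_nat_pair n k)),
         ([::], [::]), T2)
        ([:: ReadFirst],
         (Some Sep :: bit_cells (rev (digits n)), cells (encode_nat k)),
         ([::], bit_cells (digits n)), T2) (2 * n + 2).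
Proof.
move=> n0; rewrite /encode_nat_pair encode_nat_digits //.
have r1 := @run_load [::] (digits n) (cells (encode_nat k)) [::] T2.
pose T0 := (Some Sep :: bit_cells (rev (digits n)), cells (encode_nat k)).
have r2 := @run_rewind [:: ReadFirst] T0 T2 (map Bit (rev (digits n))) [:: None].
have r3 := @reach_nones [:: ReadFirst] T0 [::] (bit_cells (digits n)) 1 T2.
rewrite !cats0 in r1; rewrite -map_rev revK in r2.
have r := reach_trans r1 (reach_trans r2 r3).
rewrite /cells map_cat; apply: reach_leq r _.
by rewrite size_map size_rev; have := size_digits_le n; lia.
Qed.

(** Up to the moment when only isolated dominoes are left to print; [w'] is
    the part of the layout printed so far. *)
Lemma run_value n k w : 0 < n -> roomy n k -> forall Z,
  exists T0 x b w', layout n k = w' ++ padding b x /\ x <= n /\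
  reach ([:: ReadFirst], (Some Sep :: Z, cells (encode_nat k)),
         ([::], bit_cells (digits n)), printed w)
        ([:: Pad b], T0, ([::], bit_cells (digits x)),
         printed (w ++ encode_squares w'))
        (100 * n * (n + 10)).
Proof.
move=> n0 rk Z; case: k rk => [|[|k]] rk.
- eexists; exists n.-1, true, [seq sq n y | y <- rails].
  split; last split; [by [] | by lia |].
  apply: (@reach_leq _ _ (3 * (2 * n + 12)).+2); last by nia.
  apply: reach_step => //; apply: reach_step => //.
  exact: (@run_column [:: Pad true] _ n rails w n0 isT).
- eexists; exists n, true, [::]; split; last split => //; first by [].
  apply: (@reach_leq _ _ 2); last by nia.
  rewrite cats0; apply: reach_step => //; apply: reach_step => //; exact: reach_refl.
have {}rk : 6 * size (digits k.+2) < n := rk.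
rewrite layout_gt1 // encode_nat_digits //; set m := size _.
have [b [D DE]] : exists b D, digits k.+2 = b :: D.
  by rewrite digitsE //; do 2!eexists.
have D0 : D != [::].
  by move: DE; rewrite digitsE // => -[_ <-]; rewrite digitsE.
have x00 : 0 < n - 4 * m by lia.
have le_n : n - 4 * m + 4 * size (digits k.+2) <= n by rewrite -/m; lia.
have r1 := @run_bits (digits k.+2) [::] (Some Sep :: Z) (n - 4 * m) w n x00 le_n.
have nE : n - 4 * m + 4 * size (digits k.+2) = n by rewrite -/m; lia.
rewrite nE cats0 in r1.
have [|R' r2] := @run_skip (rev (digits k.+2)) Z [:: None] (n - 4 * m).-1
  (printed (w ++ encode_squares (chain (digits k.+2) (n - 4 * m)))) n.
  by rewrite size_rev -/m; lia.
exists (Z, Some Sep :: R'), (n - 6 * m - 1), true,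
  (chain (digits k.+2) (n - 4 * m)).
split=> //; split; first by lia.
have r := reach_trans r1 r2.
rewrite size_rev -/m in r.
have xE : (n - 4 * m).-1 - 2 * m = n - 6 * m - 1 by lia.
rewrite xE in r.
apply: (@reach_leq _ _
  (m.+1 * (16 * (2 * n + 12) + 1) + m.+1 * (4 * n + 7)).+2); last first.
  have m0 : 0 < m by rewrite /m DE.
  by nia.
rewrite DE; case: D D0 DE r => [|d D] // _ DE r.
rewrite DE in r *.
by apply: reach_step => //; apply: reach_step => //.
Qed.

Lemma size_encode_square x y : 0 < x -> y < 8 ->
  size (encode_square (sq x y)) <= x + 5.
Proof.
move=> x0 y8; rewrite encode_square_sq //.
have sy := size_encode_row y8.
rewrite -cat1s !size_cat size_map.
by have := size_digits_le x; rewrite [size [:: _]]/=; lia.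
Qed.

Lemma layout_square n k a : 0 < n -> roomy n k -> a \in layout n k ->
  exists x y, [/\ a = sq x y, 0 < x <= n & y < 8].
Proof.
have inpad b x : x <= n -> a \in padding b x ->
    exists x y, [/\ a = sq x y, 0 < x <= n & y < 8].
  elim: x b => [|x IH] b xn //=; rewrite mem_cat => /orP[|/(IH _ (ltnW xn)) //].
  move=> /mapP[y yb ->]; exists x.+1, y; split=> //.
  by move: y yb; apply/allP; case: b.
have inchain bs x0 : 0 < x0 -> x0 + 4 * size bs <= n -> a \in chain bs x0 ->
    exists x y, [/\ a = sq x y, 0 < x <= n & y < 8].
  move=> x00; elim: bs => [|b bs IH] xn.
    move=> /mapP[y yb ->]; exists x0, y; split=> //.
      by move: xn; rewrite /=; lia.
    by move: y yb; apply/allP.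
  rewrite [size _]/= in xn.
  rewrite /= mem_cat => /orP[|]; last by apply: IH; lia.
  move=> /mapP[p pb ->]; have : (p.1 < 4) && (p.2 < 8).
    by move: p pb; apply/allP; case: b.
  move=> /andP[p1 p2]; exists (x0 + 4 * size bs + p.1.+1), p.2.
  by split=> //; lia.
move=> n0; case: k => [|[|k]] rk.
- rewrite layout0 mem_cat => /orP[|]; last by apply: inpad; lia.
  move=> /mapP[y yb ->]; exists n, y; split=> //; first by rewrite n0 leqnn.
  by move: y yb; apply/allP.
- exact: inpad.
have {}rk : 6 * size (digits k.+2) < n := rk.
rewrite layout_gt1 // mem_cat => /orP[]; [apply: inchain | apply: inpad]; lia.
Qed.

Lemma size_encode_layout n k : 0 < n -> roomy n k ->
  size (encode_squares (layout n k)) <= 2 * n * (n + 5).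
Proof.
move=> n0 rk; rewrite -(size_layout n0 rk) /encode_squares size_flatten.
have : all (fun a => size (encode_square a) <= n + 5) (layout n k).
  apply/allP => a /(layout_square n0 rk)[x [y [-> /andP[x0 xn] y8]]].
  by apply: leq_trans (size_encode_square x0 y8) _; rewrite leq_add2r.
elim: (layout n k) => [|a s IH] //= /andP[sa /IH]; rewrite /shape /= in IH *.
by rewrite mulSn; apply: leq_add.
Qed.

Lemma holds_word t w : holds t ([::], cells w ++ [:: None]) ->
  word_of_tape t = map inl w.
Proof.
case=> _ /=; rewrite /word_of_tape; move: (Defs.thead t :: tright t) => s.
elim: w s => [|a w IH] [|b s] e //=.
- by have := e 0; rewrite /= => ->.
- by have := e 0.
- have /= -> := e 0; congr cons; apply: IH => i; exact: (e i.+1).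
Qed.

Lemma sim_init w :
  sim (init machine w)
      ([:: Load; Rewind; ReadFirst], ([::], cells w), ([::], [::]), ([::], [::])).
Proof.
have hold0 :
    holds (tape_of_word (map inl w : seq (symbol + void))) ([::], cells w).
  split; first by case: w.
  by case: w => [|a w] i; rewrite /= ?nth_nil //;
    [case: i => [|[]] | rewrite /cells -!map_comp].
have holdn : holds (tape_of_word ([::] : seq (symbol + void))) ([::], [::]).
  by split=> // i; case: i => [|[]].
split; rewrite ?ffunE //=; first by rewrite /insub_bseq val_insubd.
by rewrite -val_eqE /= inordK.
Qed.

Lemma iter_step_halted (c : config machine) t :
  @halting machine (cstate c) -> iter t (@step machine) c = c.
Proof. by move=> hc; elim: t => [|t IH] //=; rewrite IH /step hc. Qed.

Lemma machine_computes n k : 0 < n -> roomy n k ->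
  computes_within machine (encode_nat_pair n k) (encode_squares (layout n k))
    (200 * (n + 10) * (n + 10)).
Proof.
move=> n0 rk; have r1 := @run_init n k ([::], [::]) n0.
have [T0 [x [b [w' [layE [xn r2]]]]]] :=
  run_value [::] n0 rk (bit_cells (rev (digits n))).
have r3 := @run_pad b x T0 ([::] ++ encode_squares w') n xn.
rewrite -catA -encode_squares_cat -layE cat0s in r3.
have r4 := @run_finish T0 ([::], [::]) (encode_squares (layout n k)).
have [t' tt' []] :=
  reach_trans r1 (reach_trans r2 (reach_trans r3 r4)) (sim_init _).
set c' := iter t' _ _ => cE _ _ h2.
have halted : @halting machine (cstate c').
  by rewrite -[halting _]/(nilp (bseqval (cstate c'))) cE.
rewrite /computes_within.
have -> : 200 * (n + 10) * (n + 10) = (200 * (n + 10) * (n + 10) - t') + t'.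
  rewrite subnK //; apply: leq_trans tt' _; have := size_encode_layout n0 rk.
  by nia.
rewrite iterD -/c' iter_step_halted //.
by split=> //; exact: holds_word.
Qed.

(** * The growth rate *)

(** The sixteenth root of 2. *)
Definition growth_rate (R : realType) : R :=
  Num.sqrt (Num.sqrt (Num.sqrt (Num.sqrt 2%:R))).

Lemma growth_rate_gt1 (R : realType) : (1 < growth_rate R)%R.
Proof.
have sqrt_gt1 (x : R) : (1 < x -> 1 < Num.sqrt x)%R.
  by move=> x1; rewrite -[X in (X < _)%R]sqrtr1 ltr_sqrt // (lt_trans ltr01).
by do 4!apply/sqrt_gt1; rewrite ltr1n.
Qed.

Lemma growth_rate_exp16 (R : realType) : (growth_rate R ^+ 16 = 2%:R)%R.
Proof.
rewrite -[16]/(2 * (2 * (2 * 2)))%N !exprM !sqr_sqrtr // ?sqrtr_ge0 //.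
Qed.

(** A number [k > 1] with [m] digits is at least 2 to the power [m - 1], so
    [n] is at least [16 * (m - 1)], which exceeds [6 * m] since [m >= 2]. *)
Lemma growth_rate_roomy (R : realType) n k :
  (k%:R <= growth_rate R ^+ n)%R -> roomy n k.
Proof.
move=> kn; apply/implyP => k1; set m := size (digits k).
have m2 : 1 < m.
  rewrite /m digitsE; last by lia.
  by rewrite digitsE //; lia.
have : 16 * m.-1 <= n.
  rewrite -(ler_eXn2l (growth_rate_gt1 R)) exprM growth_rate_exp16 -natrX.
  apply: le_trans kn; rewrite ler_nat; apply: exp2_size_digits; lia.
by lia.
Qed.

Theorem theorem3p1 (R : realType) :
  exists c : R,
    [/\ (1 < c)%R,
        forall n : nat, 0 < n ->
          ([set k : nat | (k%:R <= c ^+ n)%R] `<=` tiling_numbers n)%classic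
      & exists (M : turing_machine) (p : {poly nat}),
          forall n k : nat, 0 < n -> (k%:R <= c ^+ n)%R ->
            exists G : region,
              [/\ tau G = k, #|` G| = 2 * n
                & constructs_within M (encode_nat_pair n k) G p.[n]%R]].
Proof.
exists (growth_rate R); split; first exact: growth_rate_gt1.
  move=> n n0 k /= /growth_rate_roomy rk; exists (region_of (layout n k)).
  by rewrite card_layout // tau_layout.
exists machine, (200%:P * ('X + 10%:P) * ('X + 10%:P))%R.
move=> n k n0 /growth_rate_roomy rk.
exists (region_of (layout n k)); rewrite card_layout // tau_layout //; split=> //.
exists (layout n k); first exact: perm_layout.
rewrite !(hornerM, hornerD, hornerX, hornerC); exact: machine_computes.
Qed.
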